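(* For $|q|<1$: (i) \[\sum_{n=1}^{\infty}\frac{q^n}{1-q^n}(-q^{n+1};q)_\infty=(-q;q)_\infty\left(\frac{1}{2}+ \sum_{n=1}^{\infty}\frac{q^n}{1+q^n} \right)-\frac{1}{2}\sum_{n=0}^{\infty}\frac{q^{n(n+1)/2}}{(-q;q)_n};\] (ii) \[\sum_{n=1}^{\infty}\frac{q^{2n}}{1-q^{2n}}(-q^{2n+1};q^2)_\infty=(-q;q^2)_\infty\sum_{n=1}^{\infty}\frac{q^{2n-1}}{1+q^{2n-1}}-\sum_{n=1}^{\infty}\frac{q^{n^2}}{(-q;q^2)_n}.\]
   Context: For $x\in\mathbb{C}$, $(x;q)_n=\prod_{j=0}^{n-1}(1-xq^j)$ (with $(x;q)_0=1$) and $(x;q)_\infty=\prod_{j=0}^{\infty}(1-xq^j)$. *)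

(* Defs.v *)
From Stdlib Require Import Reals.
From Coquelicot Require Import Coquelicot.

Open Scope C_scope.

(* Limit of a complex sequence; a junk value unless the sequence converges. *)
Definition Clim_seq (u : nat -> C) : C :=
  lim (T := C_CompleteNormedModule) (filtermap u eventually).

Definition CSeries (a : nat -> C) : C := Clim_seq (sum_n a).

Fixpoint qpoch (x q : C) (n : nat) : C :=
  match n with
  | O => 1
  | S m => qpoch x q m * (1 - x * q ^ m)
  end.

Definition ex_qpoch_inf (x q : C) : Prop :=
  exists l : C, filterlim (qpoch x q) eventually (locally l).

Definition qpoch_inf (x q : C) : C := Clim_seq (qpoch x q).

Lemma is_Clim_seq_unique (u : nat -> C) (l : C) :
  filterlim u eventually (locally l) -> Clim_seq u = l.
Proof.
intros H.
assert (PF : ProperFilter (filtermap u eventually)).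
{ apply filtermap_proper_filter, eventually_filter. }
apply (eq_close (V := C_NormedModule)).
apply (filterlim_locally_close (F := eventually) u); [|exact H].
apply (filterlim_locally (U := C_CompleteNormedModule)).
intros eps.
refine (complete_cauchy (T := C_CompleteNormedModule) (filtermap u eventually) PF _ eps).
clear eps.
intros eps; exists l.
exact (proj1 (filterlim_locally (U := C_UniformSpace) u l) H eps).
Qed.

Lemma is_CSeries_unique (a : nat -> C) (l : C) :
  is_series a l -> CSeries a = l.
Proof. exact (is_Clim_seq_unique (sum_n a) l). Qed.

(* Main.v *)
(* Both identities are cases of one identity in a base q and parameters with
   a b = q: put r_N = - b q^N / (1 - b q^N) and u_N = r_0 ... r_(N-1); then
     sum_(n>=1) q^n / (1 - q^n) (a q^n; q)_oo
       = (a; q)_oo sum_(N>=0) r_N - sum_(N>=1) u_N.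
   Let V_N be the left-hand side with a replaced by a q^(-N), times u_N.
   Since r_N (1 - a q^(n-1-N)) = 1 - (1 - q^n) / (1 - b q^N), the factor 1 - q^n
   cancels in V_N - V_(N+1), which becomes a telescoping series in n with value r_N (a; q)_oo - u_(N+1); as
   V_N tends to 0, summing over N gives the identity.  Part (i) is a = -q,
   b = -1, and part (ii) is the base q^2 with a = b = -q. *)
Require Import Defs.
From Stdlib Require Import Reals Lra Lia.
From Coquelicot Require Import Coquelicot.

Open Scope C_scope.

(** * Limits and series of complex numbers *)

Lemma filterlim_C_of_Cmod_bound (u : nat -> C) (l : C) (e : nat -> R) :
  (forall n, (Cmod (u n - l) <= e n)%R) -> is_lim_seq e 0 ->
  filterlim u eventually (locally l).
Proof.
intros Hu He.
apply (proj2 (filterlim_locally (U := C_UniformSpace) u l)).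
intros eps.
destruct (proj2 (is_lim_seq_spec _ _) He eps) as [N HN].
exists N; intros n Hn.
apply C_NormedModule_mixin_compat1.
specialize (HN n Hn); simpl in HN; rewrite Rminus_0_r in HN.
apply Rle_lt_trans with (2 := HN).
apply Rle_trans with (1 := Hu n), Rle_abs.
Qed.

Lemma Cmod_filterlim_le (u : nat -> C) (l : C) (M : R) :
  filterlim u eventually (locally l) -> (forall n, (Cmod (u n) <= M)%R) ->
  (Cmod l <= M)%R.
Proof.
intros Hu HM.
assert (H : is_lim_seq (fun n => Cmod (u n)) (Cmod l)).
{ apply (filterlim_comp _ _ _ u (@norm _ C_NormedModule) _ (locally l) _ Hu).
  exact (filterlim_norm (V := C_NormedModule) l). }
exact (is_lim_seq_le _ (fun _ => M) _ _ HM H (is_lim_seq_const M)).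
Qed.

Lemma filterlim_C_unique (u : nat -> C) (l l' : C) :
  filterlim u eventually (locally l) -> filterlim u eventually (locally l') ->
  l = l'.
Proof.
intros H H'.
now rewrite <- (is_Clim_seq_unique _ _ H), <- (is_Clim_seq_unique _ _ H').
Qed.

Lemma filterlim_C_bounded (u : nat -> C) (l : C) :
  filterlim u eventually (locally l) ->
  exists M, forall n, (Cmod (u n) <= M)%R.
Proof.
intros Hu.
destruct (filterlim_bounded (V := C_NormedModule) u) as [M HM].
- now exists l.
- now exists M.
Qed.

Lemma filterlim_C_scal (c : C) (u : nat -> C) (l : C) :
  filterlim u eventually (locally l) ->
  filterlim (fun n => c * u n) eventually (locally (c * l)).
Proof.
intros H.
exact (filterlim_comp _ _ _ u (fun x => c * x) _ _ _ H
  (filterlim_scal_r (V := C_NormedModule) c l)).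
Qed.

Lemma filterlim_C_minus (u v : nat -> C) (l m : C) :
  filterlim u eventually (locally l) -> filterlim v eventually (locally m) ->
  filterlim (fun n => u n - v n) eventually (locally (l - m)).
Proof.
intros Hu Hv.
refine (filterlim_comp_2 u (fun n => - v n) Cplus Hu _
  (filterlim_plus (V := C_NormedModule) l (- m))).
exact (filterlim_comp _ _ _ v Copp _ _ _ Hv
  (filterlim_opp (V := C_NormedModule) m)).
Qed.

Lemma filterlim_C_incr (u : nat -> C) (l : C) :
  filterlim u eventually (locally l) ->
  filterlim (fun n => u (S n)) eventually (locally l).
Proof.
intros H P HP; destruct (H P HP) as [N HN].
exists N; intros n Hn; apply HN; lia.
Qed.

Lemma filterlim_C_decr (u : nat -> C) (l : C) :
  filterlim (fun n => u (S n)) eventually (locally l) ->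
  filterlim u eventually (locally l).
Proof.
intros H P HP; destruct (H P HP) as [N HN].
exists (S N); intros [|n] Hn; [lia | apply HN; lia].
Qed.

Lemma sum_n_telescope (u : nat -> C) (n : nat) :
  sum_n (fun k => u k - u (S k)) n = u O - u (S n).
Proof.
induction n as [|n IH].
- now rewrite sum_O.
- rewrite sum_Sn, IH; unfold plus; simpl; ring.
Qed.

Lemma is_series_telescope (u : nat -> C) (l : C) :
  filterlim u eventually (locally l) ->
  is_series (fun n => u n - u (S n)) (u O - l).
Proof.
intros H.
apply (filterlim_ext (fun n => u O - u (S n))).
- intros n; symmetry; apply sum_n_telescope.
- apply (filterlim_C_minus (fun _ => u O)).
  + apply filterlim_const.
  + now apply filterlim_C_incr.
Qed.

Lemma is_series_C_ext (a b : nat -> C) (l : C) :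
  (forall n, a n = b n) -> is_series a l -> is_series b l.
Proof. exact (is_series_ext (V := C_NormedModule) a b l). Qed.

Lemma ex_series_C_ext (a b : nat -> C) :
  (forall n, a n = b n) -> ex_series a -> ex_series b.
Proof. exact (ex_series_ext (V := C_NormedModule) a b). Qed.

Lemma CSeries_correct (a : nat -> C) : ex_series a -> is_series a (CSeries a).
Proof. intros [l Hl]; now rewrite (is_CSeries_unique a l Hl). Qed.

Lemma CSeries_ext (a b : nat -> C) :
  (forall n, a n = b n) -> ex_series a -> CSeries a = CSeries b.
Proof.
intros Hab Ha; symmetry; apply is_CSeries_unique.
now apply (is_series_C_ext a), CSeries_correct.
Qed.

Lemma ex_series_geom_bound (a : nat -> C) (c rho : R) :
  (0 <= rho < 1)%R -> (forall n, (Cmod (a n) <= c * rho ^ n)%R) ->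
  ex_series a.
Proof.
intros Hr Ha.
apply (ex_series_le (V := C_CompleteNormedModule) a (fun n => (c * rho ^ n)%R) Ha).
apply (ex_series_scal (V := R_NormedModule) c), ex_series_geom.
rewrite Rabs_pos_eq; lra.
Qed.

Lemma Cmod_series_geom_bound (a : nat -> C) (l : C) (c rho : R) :
  (0 <= c)%R -> (0 <= rho < 1)%R ->
  (forall n, (Cmod (a n) <= c * rho ^ n)%R) ->
  is_series a l -> (Cmod l <= c / (1 - rho))%R.
Proof.
intros Hc Hr Ha Hl.
apply (Cmod_filterlim_le _ _ _ Hl); intros n.
(* The exact partial sum of the geometric series: unlike its limit [c / (1 - rho)], this bound is
   preserved by induction on [n]. *)
apply Rle_trans with (c / (1 - rho) * (1 - rho ^ S n))%R.
- induction n as [|n IH].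
  + rewrite sum_O.
    apply Rle_trans with (1 := Ha O); right; simpl; field; lra.
  + rewrite sum_Sn.
    apply Rle_trans with (1 := Cmod_triangle _ _).
    apply Rle_trans with (1 := Rplus_le_compat _ _ _ _ IH (Ha (S n))).
    right; simpl; field; lra.
- assert (0 <= c / (1 - rho))%R by (apply Rdiv_le_0_compat; lra).
  assert (0 <= rho ^ S n)%R by (apply pow_le; lra).
  generalize dependent (c / (1 - rho))%R; intros; nra.
Qed.

Lemma is_lim_seq_scal_pow (c rho : R) :
  (0 <= rho < 1)%R -> is_lim_seq (fun n => (c * rho ^ n)%R) 0.
Proof.
intros Hr.
replace (Finite 0) with (Rbar_mult c 0) by (simpl; f_equal; ring).
apply is_lim_seq_scal_l, is_lim_seq_geom.
rewrite Rabs_pos_eq; lra.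
Qed.

(** * Bounds for finite q-products and convergence of the infinite ones *)

Lemma Cmod_1_minus (z : C) : (1 - Cmod z <= Cmod (1 - z))%R.
Proof.
assert (H := Cmod_triangle (1 - z) z).
replace (1 - z + z) with (RtoC 1) in H by ring.
rewrite Cmod_1 in H; lra.
Qed.

Lemma Cmod_1_minus_pow (q : C) (n : nat) :
  (Cmod q < 1)%R -> (1 - Cmod q <= Cmod (1 - q ^ S n))%R.
Proof.
intros hq.
apply Rle_trans with (2 := Cmod_1_minus _).
rewrite Cmod_pow.
assert (H0 := Cmod_ge_0 q).
assert (Cmod q ^ n <= 1)%R by (rewrite <- (pow1 n); apply pow_incr; lra).
simpl; nra.
Qed.

Lemma Cneq_0_of_Cmod (z : C) (d : R) : (0 < d)%R -> (d <= Cmod z)%R -> z <> 0.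
Proof. intros Hd Hz; apply Cmod_gt_0; lra. Qed.

(** Each factor has modulus at most 1 + |x| |q|^j <= exp (|x| |q|^j). The induction keeps the
    partial geometric sum in the exponent; only at the end is it replaced by the full sum, giving a
    bound uniform in [n]. *)
Lemma Cmod_qpoch_bound (x q : C) (n : nat) :
  (Cmod q < 1)%R ->
  (Cmod (qpoch x q n) <= exp (Cmod x / (1 - Cmod q)))%R.
Proof.
intros hq.
assert (H0 := Cmod_ge_0 q); assert (H1 := Cmod_ge_0 x).
assert (0 <= Cmod x / (1 - Cmod q))%R by (apply Rdiv_le_0_compat; lra).
apply Rle_trans with (exp (Cmod x / (1 - Cmod q) * (1 - Cmod q ^ n))).
- induction n as [|n IH]; simpl.
  + rewrite Cmod_1, Rminus_diag, Rmult_0_r, exp_0; lra.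
  + replace (Cmod x / (1 - Cmod q) * (1 - Cmod q * Cmod q ^ n))%R
      with (Cmod x / (1 - Cmod q) * (1 - Cmod q ^ n) + Cmod x * Cmod q ^ n)%R
      by (field; lra).
    rewrite exp_plus, Cmod_mult.
    apply Rmult_le_compat; try apply Cmod_ge_0; [exact IH|].
    apply Rle_trans with (1 + Cmod x * Cmod q ^ n)%R.
    * apply Rle_trans with (1 := Cmod_triangle _ _).
      rewrite Cmod_1, Cmod_opp, Cmod_mult, Cmod_pow; lra.
    * apply exp_ineq1_le.
- assert (0 <= Cmod q ^ n)%R by (apply pow_le; lra).
  destruct (Rle_lt_or_eq_dec (Cmod x / (1 - Cmod q) * (1 - Cmod q ^ n))
    (Cmod x / (1 - Cmod q))) as [h|h]; [nra| |rewrite h; lra].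
  now left; apply exp_increasing.
Qed.

(** The difference is x q^n (x; q)_n. Its geometric decay turns the infinite product into an
    absolutely convergent telescoping series, so no logarithms are needed and vanishing factors do
    no harm. *)
Lemma qpoch_telescope_bound (x q : C) (n : nat) :
  (Cmod q < 1)%R ->
  (Cmod (qpoch x q n - qpoch x q (S n))
    <= Cmod x * exp (Cmod x / (1 - Cmod q)) * Cmod q ^ n)%R.
Proof.
intros hq; simpl.
replace (qpoch x q n - qpoch x q n * (1 - x * q ^ n))
  with (x * q ^ n * qpoch x q n) by ring.
rewrite !Cmod_mult, Cmod_pow.
assert (H := Cmod_qpoch_bound x q n hq).
assert (0 <= Cmod q ^ n)%R by (apply pow_le, Cmod_ge_0).
assert (H1 := Cmod_ge_0 x).
assert (0 <= Cmod x * Cmod q ^ n)%R by nra.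
nra.
Qed.

Lemma ex_qpoch_inf_lt1 (x q : C) : (Cmod q < 1)%R -> ex_qpoch_inf x q.
Proof.
intros hq.
destruct (ex_series_geom_bound (fun n => qpoch x q n - qpoch x q (S n))
  _ _ (conj (Cmod_ge_0 q) hq) (fun n => qpoch_telescope_bound x q n hq))
  as [l Hl].
exists (1 - l); apply filterlim_C_decr.
apply (filterlim_ext
  (fun n => 1 - sum_n (fun k => qpoch x q k - qpoch x q (S k)) n)).
- intros n; rewrite sum_n_telescope; simpl; ring.
- apply (filterlim_C_minus (fun _ => RtoC 1)); [apply filterlim_const | exact Hl].
Qed.

Lemma qpoch_inf_correct (x q : C) :
  (Cmod q < 1)%R ->
  filterlim (qpoch x q) eventually (locally (qpoch_inf x q)).
Proof.
intros hq; destruct (ex_qpoch_inf_lt1 x q hq) as [l Hl].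
unfold qpoch_inf; now rewrite (is_Clim_seq_unique _ _ Hl).
Qed.

Lemma qpoch_S_l (x q : C) (n : nat) :
  qpoch x q (S n) = (1 - x) * qpoch (x * q) q n.
Proof.
induction n as [|n IH]; [simpl; ring|].
change (qpoch x q (S (S n))) with (qpoch x q (S n) * (1 - x * q ^ S n)).
rewrite IH; simpl; ring.
Qed.

Lemma qpoch_inf_rec (x q : C) :
  (Cmod q < 1)%R -> qpoch_inf x q = (1 - x) * qpoch_inf (x * q) q.
Proof.
intros hq.
apply (filterlim_C_unique (fun n => qpoch x q (S n))).
- now apply filterlim_C_incr, qpoch_inf_correct.
- apply (filterlim_ext (fun n => (1 - x) * qpoch (x * q) q n)).
  + intros n; symmetry; apply qpoch_S_l.
  + now apply filterlim_C_scal, qpoch_inf_correct.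
Qed.

(** Sums the bounds on consecutive differences, starting from the empty product 1. The factor
    [Cmod x] makes the bound tend to 0 with [x]. *)
Lemma Cmod_qpoch_inf_minus_1 (x q : C) :
  (Cmod q < 1)%R ->
  (Cmod (qpoch_inf x q - 1)
    <= Cmod x * exp (Cmod x / (1 - Cmod q)) / (1 - Cmod q))%R.
Proof.
intros hq.
replace (qpoch_inf x q - 1) with (- (qpoch x q 0 - qpoch_inf x q)) by (simpl; ring).
rewrite Cmod_opp.
refine (Cmod_series_geom_bound _ _ _ _ _ (conj (Cmod_ge_0 q) hq)
  (fun n => qpoch_telescope_bound x q n hq)
  (is_series_telescope _ _ (qpoch_inf_correct x q hq))).
apply Rmult_le_pos; [apply Cmod_ge_0 | left; apply exp_pos].
Qed.

Lemma qpoch_inf_shift_lim (a q : C) :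
  (Cmod q < 1)%R ->
  filterlim (fun n => qpoch_inf (a * q ^ n) q) eventually (locally (RtoC 1)).
Proof.
intros hq; assert (H0 := Cmod_ge_0 q); assert (H1 := Cmod_ge_0 a).
apply (filterlim_C_of_Cmod_bound _ _ (fun n =>
  (Cmod a * exp (Cmod a / (1 - Cmod q)) / (1 - Cmod q) * Cmod q ^ n)%R)).
2: now apply is_lim_seq_scal_pow.
intros n.
apply Rle_trans with (1 := Cmod_qpoch_inf_minus_1 _ q hq).
rewrite Cmod_mult, Cmod_pow.
assert (0 <= Cmod q ^ n)%R by (apply pow_le; lra).
assert (Cmod q ^ n <= 1)%R by (rewrite <- (pow1 n); apply pow_incr; lra).
assert (Hi : (0 < / (1 - Cmod q))%R) by (apply Rinv_0_lt_compat; lra).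
(* The factor |q|^n is kept outside the exponential; inside it is bounded by 1. *)
replace (Cmod a * exp (Cmod a / (1 - Cmod q)) / (1 - Cmod q) * Cmod q ^ n)%R
  with (Cmod a * Cmod q ^ n * exp (Cmod a / (1 - Cmod q)) / (1 - Cmod q))%R
  by (unfold Rdiv; ring).
unfold Rdiv; apply Rmult_le_compat_r; [lra|].
apply Rmult_le_compat_l; [nra|].
assert (h : (Cmod a * Cmod q ^ n * / (1 - Cmod q) <= Cmod a * / (1 - Cmod q))%R).
{ apply Rmult_le_compat_r; [lra | nra]. }
destruct h as [h|h]; [left; now apply exp_increasing | rewrite h; lra].
Qed.

(** * The ratios r_N, their products u_N, and the shifted infinite products *)

Definition ratio (b q : C) (N : nat) : C := - b * q ^ N / (1 - b * q ^ N).

Fixpoint ratio_prod (b q : C) (N : nat) : C :=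
  match N with
  | O => 1
  | S m => ratio b q m * ratio_prod b q m
  end.

(* When [a * b = q], this is [ratio_prod b q N * (a q^(n-N); q)_oo]; the
   recursion avoids negative powers and allows [q = 0]. *)
Fixpoint shifted (a b q : C) (N n : nat) : C :=
  match N, n with
  | O, _ => qpoch_inf (a * q ^ n) q
  | S _, O => qpoch_inf a q
  | S m, S k => ratio b q m * shifted a b q m k
  end.

(** If [a * b = q] and [q] is nonzero, then r_j (1 - a q^(-j-1)) = 1 for every j, so u_N cancels the
    N extra factors of (a q^(-N); q)_oo. The recursion takes the resulting value as its boundary
    value. *)
Lemma shifted_0_r (a b q : C) (N : nat) : shifted a b q N 0 = qpoch_inf a q.
Proof. destruct N; simpl; [f_equal; ring | reflexivity]. Qed.

(** Formally, this splits off the first factor 1 - a q^(n-N) of the infinite product: multiplied by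
    -b q^N it becomes q^(n+1) - b q^N, because [a * b = q]. The statement thus contains no negative
    power. *)
Lemma shifted_rec (a b q : C) (N n : nat) :
  (Cmod q < 1)%R -> a * b = q -> (forall k, 1 - b * q ^ k <> 0) ->
  shifted a b q N (S n) * (q ^ S n - b * q ^ N)
    = - b * q ^ N * shifted a b q N n.
Proof.
intros hq hab hd; revert n; induction N as [|N IH]; intros n.
- simpl shifted.
  rewrite (qpoch_inf_rec (a * q ^ n) q hq).
  replace (a * q ^ n * q) with (a * (q * q ^ n)) by ring.
  replace (q ^ S n - b * q ^ 0) with (a * b * q ^ n - b)
    by (rewrite hab; simpl; ring).
  simpl; ring.
- destruct n as [|n].
  (* On the boundary both shifted products reduce to (a; q)_oo, and the claim is the definition of
     r_N. *)
  + change (shifted a b q (S N) 1) with (ratio b q N * shifted a b q N 0).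
    rewrite !shifted_0_r; unfold ratio; simpl; field; apply hd.
  + change (ratio b q N * shifted a b q N (S n) * (q * q ^ S n - b * (q * q ^ N))
      = - b * (q * q ^ N) * (ratio b q N * shifted a b q N n)).
    transitivity (ratio b q N * q
      * (shifted a b q N (S n) * (q ^ S n - b * q ^ N))); [ring|].
    rewrite IH; ring.
Qed.

Lemma shifted_lim (a b q : C) (N : nat) :
  (Cmod q < 1)%R ->
  filterlim (shifted a b q N) eventually (locally (ratio_prod b q N)).
Proof.
intros hq; induction N as [|N IH].
- now apply qpoch_inf_shift_lim.
- apply filterlim_C_decr.
  exact (filterlim_C_scal (ratio b q N) _ _ IH).
Qed.

(** Here and below, [d] keeps all denominators 1 - b q^k uniformly away from 0, so that r_N decays
    geometrically. *)
Lemma Cmod_ratio (b q : C) (d : R) (N : nat) :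
  (0 < d)%R -> (forall k, (d <= Cmod (1 - b * q ^ k))%R) ->
  (Cmod (ratio b q N) <= Cmod b / d * Cmod q ^ N)%R.
Proof.
intros Hd Hk; unfold ratio.
assert (H1 : (0 <= Cmod b * Cmod q ^ N)%R)
  by (apply Rmult_le_pos; [|apply pow_le]; apply Cmod_ge_0).
rewrite Cmod_div, Cmod_mult, Cmod_opp, Cmod_pow
  by exact (Cneq_0_of_Cmod _ _ Hd (Hk N)).
replace (Cmod b / d * Cmod q ^ N)%R with (Cmod b * Cmod q ^ N * / d)%R
  by (unfold Rdiv; ring).
apply Rmult_le_compat_l; [exact H1|].
now apply Rinv_le_contravar.
Qed.

(** Passing from N to N + 1 multiplies a bound by at most max(1, |r_N|). Since r_N tends to 0, this
    factor is eventually 1, so one bound serves all N and n. *)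
Lemma shifted_bounded (a b q : C) (d : R) :
  (Cmod q < 1)%R -> (0 < d)%R -> (forall k, (d <= Cmod (1 - b * q ^ k))%R) ->
  exists K, forall N n, (Cmod (shifted a b q N n) <= K)%R.
Proof.
intros hq Hd Hk.
assert (Hstep : forall N K, (forall n, Cmod (shifted a b q N n) <= K)%R ->
  (forall n, Cmod (shifted a b q (S N) n)
     <= Rmax 1 (Cmod (ratio b q N)) * K)%R).
{ intros N K HK.
  assert (K0 := Rle_trans _ _ _ (Cmod_ge_0 _) (HK O)).
  assert (M1 := Rmax_l 1 (Cmod (ratio b q N))).
  assert (M2 := Rmax_r 1 (Cmod (ratio b q N))).
  intros [|n].
  - specialize (HK O); rewrite shifted_0_r in *; nra.
  - simpl; rewrite Cmod_mult.
    apply Rmult_le_compat; auto using Cmod_ge_0. }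
assert (Hfin : forall J, exists K, forall N, (N <= J)%nat ->
  forall n, (Cmod (shifted a b q N n) <= K)%R).
{ induction J as [|J [K HK]].
  - destruct (filterlim_C_bounded _ _ (shifted_lim a b q 0 hq)) as [K HK].
    exists K; intros N HN; replace N with O by lia; exact HK.
  - exists (Rmax 1 (Cmod (ratio b q J)) * K)%R; intros N HN.
    destruct (Nat.eq_dec N (S J)) as [->|hN].
    + apply Hstep; intros n; apply HK; lia.
    + intros n.
      assert (h := HK N ltac:(lia) n).
      assert (h0 := Cmod_ge_0 (shifted a b q N n)).
      assert (M1 := Rmax_l 1 (Cmod (ratio b q J))).
      nra. }
(* Choose [J] with |r_N| < 1 for all N >= J: the bound valid up to [J] then propagates unchanged. *)
assert (Hlim := is_lim_seq_scal_pow (Cmod b / d) _ (conj (Cmod_ge_0 q) hq)).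
destruct (proj2 (is_lim_seq_spec _ _) Hlim (mkposreal 1 Rlt_0_1)) as [J HJ].
destruct (Hfin J) as [K HK].
exists K; intros N; destruct (Nat.le_ge_cases N J) as [hN|hN]; [now apply HK|].
induction hN as [|N hN IH]; [now apply HK|].
intros n.
apply Rle_trans with (1 := Hstep N K IH n).
rewrite Rmax_left; [lra|].
apply Rle_trans with (1 := Cmod_ratio b q d N Hd Hk).
specialize (HJ N hN); simpl in HJ; rewrite Rminus_0_r in HJ.
apply Rle_trans with (1 := Rle_abs _); lra.
Qed.

(** * The Lambert-type series V_N and the general identity *)

Lemma Cmod_lambert_term (q z : C) (K : R) (n : nat) :
  (Cmod q < 1)%R -> (Cmod z <= K)%R ->
  (Cmod (q ^ S n / (1 - q ^ S n) * z) <= K / (1 - Cmod q) * Cmod q ^ n)%R.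
Proof.
intros hq HK.
assert (H := Cmod_1_minus_pow q n hq).
assert (h0 := Cmod_ge_0 q); assert (hz := Cmod_ge_0 z).
rewrite Cmod_mult, Cmod_div, Cmod_pow
  by (apply (Cneq_0_of_Cmod _ (1 - Cmod q)); lra).
assert (hp : (0 <= Cmod q ^ n)%R) by now apply pow_le.
replace (K / (1 - Cmod q) * Cmod q ^ n)%R
  with (Cmod q ^ n * / (1 - Cmod q) * K)%R by (unfold Rdiv; ring).
assert (hi := Rinv_le_contravar (1 - Cmod q) _ ltac:(lra) H).
assert (hi0 : (0 < / Cmod (1 - q ^ S n))%R) by (apply Rinv_0_lt_compat; lra).
unfold Rdiv.
apply Rmult_le_compat; try lra.
- apply Rmult_le_pos; [now apply pow_le | lra].
- apply Rmult_le_compat; try lra; [now apply pow_le|].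
  simpl; nra.
Qed.

Lemma ex_series_lambert (q : C) (z : nat -> C) (K : R) :
  (Cmod q < 1)%R -> (forall n, (Cmod (z n) <= K)%R) ->
  ex_series (fun n => q ^ S n / (1 - q ^ S n) * z n).
Proof.
intros hq HK.
apply (ex_series_geom_bound _ (K / (1 - Cmod q)) _ (conj (Cmod_ge_0 q) hq)).
intros n; exact (Cmod_lambert_term q _ K n hq (HK n)).
Qed.

(** This is V_N, with the outer factor u_N absorbed into [shifted]. *)
Definition lambert (a b q : C) (N : nat) : C :=
  CSeries (fun n => q ^ S n / (1 - q ^ S n) * shifted a b q N (S n)).

Lemma lambert_step (a b q : C) (d : R) (N : nat) :
  (Cmod q < 1)%R -> a * b = q ->
  (0 < d)%R -> (forall k, (d <= Cmod (1 - b * q ^ k))%R) ->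
  lambert a b q N - lambert a b q (S N)
    = ratio b q N * qpoch_inf a q - ratio_prod b q (S N).
Proof.
intros hq hab Hd Hk.
destruct (shifted_bounded a b q d hq Hd Hk) as [K HK].
assert (hN : forall N, is_series
  (fun n => q ^ S n / (1 - q ^ S n) * shifted a b q N (S n)) (lambert a b q N)).
{ intros M; apply CSeries_correct, (ex_series_lambert q _ K hq); auto. }
(* The termwise difference is summed in two ways: as a difference of two convergent series, and as
   r_N times a telescoping series in n. *)
apply (filterlim_C_unique (sum_n (fun n =>
  q ^ S n / (1 - q ^ S n) * shifted a b q N (S n)
  - q ^ S n / (1 - q ^ S n) * shifted a b q (S N) (S n)))).
{ exact (is_series_minus (V := C_NormedModule) _ _ _ _ (hN N) (hN (S N))). }
replace (ratio b q N * qpoch_inf a q - ratio_prod b q (S N))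
  with (ratio b q N * (shifted a b q N 0 - ratio_prod b q N))
  by (rewrite shifted_0_r; simpl; ring).
apply (is_series_C_ext
  (fun n => ratio b q N * (shifted a b q N n - shifted a b q N (S n)))).
2: { apply (is_series_scal (V := C_NormedModule) (ratio b q N)).
     now apply is_series_telescope, shifted_lim. }
intros n.
assert (hb : forall k, 1 - b * q ^ k <> 0)
  by (intros k; exact (Cneq_0_of_Cmod _ _ Hd (Hk k))).
assert (hrec := shifted_rec a b q N n hq hab hb).
change (shifted a b q (S N) (S n)) with (ratio b q N * shifted a b q N n).
assert (hn : 1 - q ^ S n <> 0).
{ apply (Cneq_0_of_Cmod _ (1 - Cmod q)); [lra | now apply Cmod_1_minus_pow]. }
specialize (hb N); unfold ratio.
set (t := shifted a b q N n) in *; set (t' := shifted a b q N (S n)) in *.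
set (Q := q ^ S n) in *; set (B := q ^ N) in *.
(* Both sides equal this value: [hrec] replaces -b B t by t' (Q - b B), and on the right the
   numerator becomes t' (1 - Q), which cancels the Lambert denominator. *)
transitivity (Q * t' / (1 - b * B)).
- replace (- b * B / (1 - b * B) * (t - t'))
    with ((- b * B * t + b * B * t') / (1 - b * B)) by now field.
  rewrite <- hrec; now field.
- replace (Q / (1 - Q) * t' - Q / (1 - Q) * (- b * B / (1 - b * B) * t))
    with (Q / (1 - Q) * ((t' * (1 - b * B) - (- b * B * t)) / (1 - b * B)))
    by now field.
  rewrite <- hrec; now field.
Qed.

Lemma lambert_lim (a b q : C) (d : R) :
  (Cmod q < 1)%R -> (0 < d)%R -> (forall k, (d <= Cmod (1 - b * q ^ k))%R) ->
  filterlim (lambert a b q) eventually (locally (RtoC 0)).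
Proof.
intros hq Hd Hk.
destruct (shifted_bounded a b q d hq Hd Hk) as [K HK].
assert (K0 := Rle_trans _ _ _ (Cmod_ge_0 _) (HK O O)).
assert (hb0 := Cmod_ge_0 b); assert (hq0 := Cmod_ge_0 q).
assert (hbd : (0 <= Cmod b / d)%R) by (apply Rdiv_le_0_compat; lra).
(* At index N + 1 every term, having n >= 1, carries the factor r_N, and the remaining factors are
   bounded uniformly in N; hence V_(N+1) is O(|q|^N). *)
apply filterlim_C_decr.
apply (filterlim_C_of_Cmod_bound _ _ (fun N =>
  (Cmod b / d * K / (1 - Cmod q) / (1 - Cmod q) * Cmod q ^ N)%R)).
2: now apply is_lim_seq_scal_pow.
intros N.
replace (lambert a b q (S N) - 0) with (lambert a b q (S N)) by ring.
assert (hp : (0 <= Cmod q ^ N)%R) by now apply pow_le.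
assert (Hz : forall n, (Cmod (shifted a b q (S N) (S n))
  <= Cmod b / d * Cmod q ^ N * K)%R).
{ intros n; simpl; rewrite Cmod_mult.
  apply Rmult_le_compat; auto using Cmod_ge_0.
  now apply Cmod_ratio. }
replace (Cmod b / d * K / (1 - Cmod q) / (1 - Cmod q) * Cmod q ^ N)%R
  with (Cmod b / d * Cmod q ^ N * K / (1 - Cmod q) / (1 - Cmod q))%R
  by (unfold Rdiv; ring).
refine (Cmod_series_geom_bound _ _ _ (Cmod q) _ (conj hq0 hq)
  (fun n => Cmod_lambert_term q _ _ n hq (Hz n))
  (CSeries_correct _ (ex_series_lambert q _ _ hq Hz))).
apply Rdiv_le_0_compat; [|lra].
apply Rmult_le_pos; [apply Rmult_le_pos|]; lra.
Qed.

Lemma ex_series_ratio (b q : C) (d : R) :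
  (Cmod q < 1)%R -> (0 < d)%R -> (forall k, (d <= Cmod (1 - b * q ^ k))%R) ->
  ex_series (ratio b q).
Proof.
intros hq Hd Hk.
apply (ex_series_geom_bound _ (Cmod b / d) _ (conj (Cmod_ge_0 q) hq)).
intros n; now apply Cmod_ratio.
Qed.

Lemma ex_series_ratio_prod (b q : C) (d : R) :
  (Cmod q < 1)%R -> (0 < d)%R -> (forall k, (d <= Cmod (1 - b * q ^ k))%R) ->
  ex_series (fun N => ratio_prod b q (S N)).
Proof.
intros hq Hd Hk.
(* Since u_N is the limit in n of [shifted a b q N n] for any [a], the choice [a = 0] yields a bound
   on u_N; the factor r_N then gives geometric decay of u_(N+1). *)
destruct (shifted_bounded 0 b q d hq Hd Hk) as [K HK].
apply (ex_series_geom_bound _ (Cmod b / d * K) (Cmod q) (conj (Cmod_ge_0 q) hq)).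
intros N; simpl; rewrite Cmod_mult.
replace (Cmod b / d * K * Cmod q ^ N)%R with (Cmod b / d * Cmod q ^ N * K)%R by ring.
apply Rmult_le_compat; auto using Cmod_ge_0.
- now apply Cmod_ratio.
- exact (Cmod_filterlim_le _ _ _ (shifted_lim 0 b q N hq) (HK N)).
Qed.

Lemma ex_series_lambert_qpoch (a q : C) :
  (Cmod q < 1)%R ->
  ex_series (fun n => q ^ S n / (1 - q ^ S n) * qpoch_inf (a * q ^ S n) q).
Proof.
intros hq.
destruct (filterlim_C_bounded _ _ (qpoch_inf_shift_lim a q hq)) as [K HK].
apply (ex_series_lambert q _ K hq); intros n; exact (HK (S n)).
Qed.

Lemma CSeries_lambert_qpoch (a b q : C) (d : R) :
  (Cmod q < 1)%R -> a * b = q ->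
  (0 < d)%R -> (forall k, (d <= Cmod (1 - b * q ^ k))%R) ->
  CSeries (fun n => q ^ S n / (1 - q ^ S n) * qpoch_inf (a * q ^ S n) q)
  = qpoch_inf a q * CSeries (ratio b q)
    - CSeries (fun N => ratio_prod b q (S N)).
Proof.
intros hq hab Hd Hk.
(* The left-hand side is V_0 by conversion. The sum of V_N - V_(N+1) over N is V_0 by telescoping,
   and the right-hand side by [lambert_step]. *)
change (lambert a b q 0 = qpoch_inf a q * CSeries (ratio b q)
  - CSeries (fun N => ratio_prod b q (S N))).
replace (lambert a b q 0) with (lambert a b q 0 - 0) by ring.
apply (filterlim_C_unique
  (sum_n (fun N => lambert a b q N - lambert a b q (S N)))).
{ now apply is_series_telescope, (lambert_lim a b q d). }
apply (is_series_C_ext (fun N =>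
  qpoch_inf a q * ratio b q N - ratio_prod b q (S N))).
{ intros N; rewrite (lambert_step a b q d) by assumption; ring. }
apply (is_series_minus (V := C_NormedModule)
  (fun N => qpoch_inf a q * ratio b q N) (fun N => ratio_prod b q (S N))).
- apply (is_series_scal (V := C_NormedModule) (qpoch_inf a q)).
  now apply CSeries_correct, (ex_series_ratio b q d).
- now apply CSeries_correct, (ex_series_ratio_prod b q d).
Qed.

(** * Closed form of u_N and specialization to the bases q and q^2 *)

Lemma qpoch_neq_0 (x q : C) (n : nat) :
  (forall k, 1 - x * q ^ k <> 0) -> qpoch x q n <> 0.
Proof.
intros Hk; induction n as [|n IH]; simpl.
- exact C1_nz.
- now apply Cmult_neq_0.
Qed.

Lemma triangle_S (n : nat) :
  (S n * (S n - 1) / 2 = n + n * (n - 1) / 2)%nat.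
Proof.
rewrite <- Nat.div_add_l by lia; f_equal.
destruct n; simpl; lia.
Qed.

Lemma triangle_double (n : nat) : (2 * (n * (n - 1) / 2) = n * (n - 1))%nat.
Proof.
induction n as [|n IH]; [reflexivity|].
rewrite triangle_S, Nat.mul_add_distr_l, IH.
destruct n; simpl; lia.
Qed.

(** The numerators contribute the exponents 0 + 1 + ... + (n - 1) of q, hence the triangular
    number. *)
Lemma ratio_prod_eq (b q : C) (n : nat) :
  (forall k, 1 - b * q ^ k <> 0) ->
  ratio_prod b q n = (- b) ^ n * q ^ (n * (n - 1) / 2) / qpoch b q n.
Proof.
intros Hk; induction n as [|n IH].
- simpl; field.
- change (ratio b q n * ratio_prod b q n
    = (- b) * (- b) ^ n * q ^ (S n * (S n - 1) / 2)
      / (qpoch b q n * (1 - b * q ^ n))).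
  rewrite triangle_S, IH, Cpow_add_r; unfold ratio; field.
  split; [apply Hk | now apply qpoch_neq_0].
Qed.

Lemma lambert_identity_base_q (q : C) (hq : (Cmod q < 1)%R) :
  (ex_series (fun n : nat =>
     q ^ (S n) / (1 - q ^ (S n)) * qpoch_inf (- q ^ (S n + 1)) q) /\
   ex_series (fun n : nat => q ^ (S n) / (1 + q ^ (S n))) /\
   ex_series (fun n : nat => q ^ (n * (n + 1) / 2) / qpoch (- q) q n)) /\
  CSeries (fun n : nat =>
     q ^ (S n) / (1 - q ^ (S n)) * qpoch_inf (- q ^ (S n + 1)) q)
  = qpoch_inf (- q) q
      * (1 / 2 + CSeries (fun n : nat => q ^ (S n) / (1 + q ^ (S n))))
    - 1 / 2 * CSeries (fun n : nat =>
                q ^ (n * (n + 1) / 2) / qpoch (- q) q n).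
Proof.
assert (h0 := Cmod_ge_0 q).
assert (Hd : (0 < 1 - Cmod q)%R) by lra.
(* With b = -1 the denominator is 1 + q^k: it equals 2 at k = 0, and |q^k| <= |q| afterwards. *)
assert (Hk : forall k, (1 - Cmod q <= Cmod (1 - - (1) * q ^ k))%R).
{ intros [|k].
  - replace (1 - - (1) * q ^ 0) with (RtoC 2) by (simpl; ring).
    rewrite Cmod_R, Rabs_pos_eq; lra.
  - apply Rle_trans with (2 := Cmod_1_minus _).
    rewrite Cmod_mult, Cmod_opp, Cmod_1, Cmod_pow.
    assert (Cmod q ^ k <= 1)%R by (rewrite <- (pow1 k); apply pow_incr; lra).
    simpl; nra. }
assert (Hn : forall k, 1 - - (1) * q ^ k <> 0)
  by (intros k; exact (Cneq_0_of_Cmod _ _ Hd (Hk k))).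
assert (EL : forall n, q ^ S n / (1 - q ^ S n) * qpoch_inf (- q * q ^ S n) q
  = q ^ S n / (1 - q ^ S n) * qpoch_inf (- q ^ (S n + 1)) q).
{ intros n; do 2 f_equal; rewrite Cpow_add_r; simpl; ring. }
assert (ER : forall n, ratio (- (1)) q n = q ^ n / (1 + q ^ n)).
{ intros n; unfold ratio, Cdiv; f_equal; [ring | f_equal; ring]. }
(* The factor 1/2 comes from (-1; q)_(n+1) = 2 (-q; q)_n. *)
assert (EU : forall n, ratio_prod (- (1)) q (S n)
  = 1 / 2 * (q ^ (n * (n + 1) / 2) / qpoch (- q) q n)).
{ intros n; rewrite ratio_prod_eq, qpoch_S_l by exact Hn.
  replace (- - (1)) with (RtoC 1) by ring.
  replace (- (1) * q) with (- q) by ring.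
  rewrite Cpow_1_l.
  replace (S n * (S n - 1))%nat with (n * (n + 1))%nat
    by (rewrite Nat.sub_succ, Nat.sub_0_r; lia).
  field; apply qpoch_neq_0; intros k.
  replace (- q * q ^ k) with (- (1) * q ^ S k) by (simpl; ring).
  apply Hn. }
assert (XR := ex_series_ratio (- (1)) q _ hq Hd Hk).
assert (XU := ex_series_ratio_prod (- (1)) q _ hq Hd Hk).
assert (XL := ex_series_lambert_qpoch (- q) q hq).
assert (XR' : ex_series (fun n => q ^ S n / (1 + q ^ S n))).
{ apply (ex_series_C_ext (fun n => ratio (- (1)) q (S n)) _ (fun n => ER (S n))).
  now apply (ex_series_incr_1 (V := C_NormedModule) (ratio (- (1)) q)). }
assert (XU' : ex_series (fun n => q ^ (n * (n + 1) / 2) / qpoch (- q) q n)).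
{ apply (ex_series_C_ext (fun n => 2 * ratio_prod (- (1)) q (S n))).
  - intros n; rewrite EU.
    set (x := _ / qpoch _ _ _); field.
  - exact (ex_series_scal (V := C_NormedModule) (RtoC 2) _ XU). }
split; [split; [|split]|].
- now apply (ex_series_C_ext _ _ EL).
- exact XR'.
- exact XU'.
- rewrite <- (CSeries_ext _ _ EL XL).
  rewrite (CSeries_lambert_qpoch (- q) (- (1)) q (1 - Cmod q) hq)
    by (exact Hd || exact Hk || ring).
  rewrite (CSeries_ext _ _ EU XU).
  f_equal; [f_equal|f_equal].
  (* The separate 1/2 in the identity is the term r_0, split off so that the remaining sum starts at
     exponent 1. *)
  + apply is_CSeries_unique, (is_series_decr_1 (V := C_NormedModule)).
    apply (is_series_C_ext _ _ _ (fun n => eq_sym (ER (S n)))).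
    rewrite ER.
    replace (plus _ _) with (CSeries (fun n => q ^ S n / (1 + q ^ S n))).
    * now apply CSeries_correct.
    * unfold plus, opp; simpl; field.
  + apply is_CSeries_unique.
    exact (is_series_scal (V := C_NormedModule) (1 / 2) _ _
      (CSeries_correct _ XU')).
Qed.

Lemma lambert_identity_base_q2 (q : C) (hq : (Cmod q < 1)%R) :
  (ex_series (fun n : nat =>
     q ^ (2 * S n) / (1 - q ^ (2 * S n))
       * qpoch_inf (- q ^ (2 * S n + 1)) (q ^ 2)) /\
   ex_series (fun n : nat =>
     q ^ (2 * S n - 1) / (1 + q ^ (2 * S n - 1))) /\
   ex_series (fun n : nat =>
     q ^ (S n * S n) / qpoch (- q) (q ^ 2) (S n))) /\
  CSeries (fun n : nat =>
     q ^ (2 * S n) / (1 - q ^ (2 * S n))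
       * qpoch_inf (- q ^ (2 * S n + 1)) (q ^ 2))
  = qpoch_inf (- q) (q ^ 2)
      * CSeries (fun n : nat =>
          q ^ (2 * S n - 1) / (1 + q ^ (2 * S n - 1)))
    - CSeries (fun n : nat =>
        q ^ (S n * S n) / qpoch (- q) (q ^ 2) (S n)).
Proof.
assert (h0 := Cmod_ge_0 q).
assert (Hd : (0 < 1 - Cmod q)%R) by lra.
assert (hq2 : (Cmod (q ^ 2) < 1)%R) by (rewrite Cmod_pow; simpl; nra).
assert (Hp : forall k, q * (q ^ 2) ^ k = q ^ S (2 * k)).
{ intros k; rewrite <- Cpow_mult_r; reflexivity. }
(* In base q^2 with b = -q the denominators are 1 + q^(2k+1), and |q^(2k+1)| <= |q|. *)
assert (Hk : forall k, (1 - Cmod q <= Cmod (1 - - q * (q ^ 2) ^ k))%R).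
{ intros k; apply Rle_trans with (2 := Cmod_1_minus _).
  replace (- q * (q ^ 2) ^ k) with (- q ^ S (2 * k)) by (rewrite <- Hp; ring).
  rewrite Cmod_opp, Cmod_pow, <- tech_pow_Rmult.
  assert (Cmod q ^ (2 * k) <= 1)%R
    by (rewrite <- (pow1 (2 * k)); apply pow_incr; lra).
  nra. }
assert (Hn : forall k, 1 - - q * (q ^ 2) ^ k <> 0)
  by (intros k; exact (Cneq_0_of_Cmod _ _ Hd (Hk k))).
assert (EL : forall n, (q ^ 2) ^ S n / (1 - (q ^ 2) ^ S n)
    * qpoch_inf (- q * (q ^ 2) ^ S n) (q ^ 2)
  = q ^ (2 * S n) / (1 - q ^ (2 * S n))
    * qpoch_inf (- q ^ (2 * S n + 1)) (q ^ 2)).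
{ intros n; rewrite <- Cpow_mult_r; do 2 f_equal.
  rewrite Cpow_add_r, Cpow_1_r; ring. }
assert (ER : forall n, ratio (- q) (q ^ 2) n
  = q ^ (2 * S n - 1) / (1 + q ^ (2 * S n - 1))).
{ intros n; replace (2 * S n - 1)%nat with (S (2 * n)) by lia.
  rewrite <- Hp; unfold ratio, Cdiv; f_equal; [ring | f_equal; ring]. }
assert (EU : forall n, ratio_prod (- q) (q ^ 2) (S n)
  = q ^ (S n * S n) / qpoch (- q) (q ^ 2) (S n)).
{ intros n; rewrite ratio_prod_eq by exact Hn.
  unfold Cdiv; f_equal.
  replace (- - q) with q by ring.
  (* The powers of -b give exponent n + 1 and the doubled triangular number gives (n + 1) n;
     together (n + 1)^2. *)
  rewrite <- Cpow_mult_r, <- Cpow_add_r; f_equal.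
  rewrite triangle_double; simpl; lia. }
assert (XR := ex_series_ratio (- q) (q ^ 2) _ hq2 Hd Hk).
assert (XU := ex_series_ratio_prod (- q) (q ^ 2) _ hq2 Hd Hk).
assert (XL := ex_series_lambert_qpoch (- q) (q ^ 2) hq2).
split; [split; [|split]|].
- now apply (ex_series_C_ext _ _ EL).
- now apply (ex_series_C_ext _ _ ER).
- now apply (ex_series_C_ext _ _ EU).
- rewrite <- (CSeries_ext _ _ EL XL), <- (CSeries_ext _ _ ER XR),
    <- (CSeries_ext _ _ EU XU).
  apply (CSeries_lambert_qpoch (- q) (- q) (q ^ 2) (1 - Cmod q) hq2);
    [simpl; ring | exact Hd | exact Hk].
Qed.

(* Sums starting at n = 1 are written with [S n], n ranging over nat. *)
Theorem theorem1p5 (q : C) (hq : (Cmod q < 1)%R) :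
  (* all the infinite products and series converge *)
  ((forall x : C, ex_qpoch_inf x q) /\
   (forall x : C, ex_qpoch_inf x (q ^ 2)) /\
   ex_series (fun n : nat =>
     q ^ (S n) / (1 - q ^ (S n)) * qpoch_inf (- q ^ (S n + 1)) q) /\
   ex_series (fun n : nat => q ^ (S n) / (1 + q ^ (S n))) /\
   ex_series (fun n : nat => q ^ (n * (n + 1) / 2) / qpoch (- q) q n) /\
   ex_series (fun n : nat =>
     q ^ (2 * S n) / (1 - q ^ (2 * S n))
       * qpoch_inf (- q ^ (2 * S n + 1)) (q ^ 2)) /\
   ex_series (fun n : nat =>
     q ^ (2 * S n - 1) / (1 + q ^ (2 * S n - 1))) /\
   ex_series (fun n : nat =>
     q ^ (S n * S n) / qpoch (- q) (q ^ 2) (S n)))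
  /\
  (* (i) *)
  CSeries (fun n : nat =>
     q ^ (S n) / (1 - q ^ (S n)) * qpoch_inf (- q ^ (S n + 1)) q)
  = qpoch_inf (- q) q
      * (1 / 2 + CSeries (fun n : nat => q ^ (S n) / (1 + q ^ (S n))))
    - 1 / 2 * CSeries (fun n : nat =>
                q ^ (n * (n + 1) / 2) / qpoch (- q) q n)
  /\
  (* (ii) *)
  CSeries (fun n : nat =>
     q ^ (2 * S n) / (1 - q ^ (2 * S n))
       * qpoch_inf (- q ^ (2 * S n + 1)) (q ^ 2))
  = qpoch_inf (- q) (q ^ 2)
      * CSeries (fun n : nat =>
          q ^ (2 * S n - 1) / (1 + q ^ (2 * S n - 1)))
    - CSeries (fun n : nat =>
        q ^ (S n * S n) / qpoch (- q) (q ^ 2) (S n)).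
Proof.
assert (hq2 : (Cmod (q ^ 2) < 1)%R).
{ assert (h0 := Cmod_ge_0 q); rewrite Cmod_pow; simpl; nra. }
destruct (lambert_identity_base_q q hq) as [[L1 [R1 U1]] E1].
destruct (lambert_identity_base_q2 q hq) as [[L2 [R2 U2]] E2].
repeat split; trivial; intros x; now apply ex_qpoch_inf_lt1.
Qed.
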